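(* Let $\kappa,\ell\in\mathbb N$, let $Y\subseteq\mathcal A_\kappa^{\mathbb Z}$ be a strictly ergodic subshift with unique invariant probability measure $\mu_Y$, and let $h\in\mathcal F(\kappa,\ell)$ be a permutative block code of length $\ell$. Then $X=\eta_h^{-1}(Y)$ is strictly ergodic if and only if there exists $y\in Y$ such that $$\lim_{n\to\infty}\ \sup_{k\in\mathbb N}\ D^{\mathrm{ap}}\left(w,y_{[k,k+n]}\right)=0\qquad(1)$$ holds for all $w\in\mathcal W(Y)$. Moreover, for $y\in Y$ and $w\in\mathcal W(Y)$, condition (1) is equivalent to $$\lim_{n\to\infty}\ \sup_{k\in\mathbb N}\ \max_{u,u'\in\mathcal A_\kappa^{\ell-1}}\left(\nu^{\mathrm{ap}}_{u\mapsto u'}\left(w,y_{[k,k+n]}\right)-\frac{\mu_Y\left([w]^+_{|w|}\right)}{\kappa^{\ell-1}}\right)=0 .\qquad(2)$$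
   Context: $\mathbb N=\{1,2,\dots\}$, $\mathcal A_\kappa=\{0,\dots,\kappa-1\}$, and $\mathcal A_\kappa^*$ is the set of finite words (including the empty word); $|w|$ is the length of $w=w_0\ldots w_{|w|-1}$ and $x_{[k,n]}=x_k\ldots x_n$ (empty if $n<k$). $\mathcal A_\kappa^{\mathbb Z}$ carries the product topology; $\sigma$ is the left shift, $\sigma(x)_n=x_{n+1}$. A subshift is a closed $\sigma$-invariant subset, and $\mathcal W(Y)$ is the set of finite words occurring in sequences of $Y$. Strictly ergodic means minimal (all orbits dense) and having exactly one invariant Borel probability measure. For $w\in\mathcal A_\kappa^n$, $[w]^+_n=\{x\mid x_k=w_k,\ 0\le k\le n-1\}$. A block code of length $\ell$ is a map $h:\mathcal A_\kappa^\ell\to\mathcal A_\kappa$; the set of these is $\mathcal F(\kappa,\ell)$. The sliding block code is $\eta_h(x)_n=h(x_{[n,n+\ell-1]})$. $h$ is permutative if for every $u\in\mathcal A_\kappa^{\ell-1}$ both maps $a\mapsto h(ua)$ and $a\mapsto h(au)$ are permutations of $\mathcal A_\kappa$. For permutative $h$, $w\in\mathcal A_\kappa^*$ and $u\in\mathcal A_\kappa^{\ell-1}$, there is a unique word $\xi^u(w)\in\mathcal A_\kappa^{|w|+\ell-1}$ starting with $u$ and satisfying $h(\xi^u(w)_{[n,n+\ell-1]})=w_n$ for $0\le n\le|w|-1$; the prefix permutation $\Phi_w$ of $\mathcal A_\kappa^{\ell-1}$ sends $u$ to the last $\ell-1$ letters of $\xi^u(w)$ (so $\Phi$ of the empty word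 is the identity). For $w,v\in\mathcal W(Y)$ with $|w|\le|v|$ and $u,u'\in\mathcal A_\kappa^{\ell-1}$ put $\mathrm{Ap}(w,v)=\{0\le j\le|v|-|w|\mid v_{[j,j+|w|-1]}=w\}$, $\mathrm{Ap}_{u\mapsto u'}(w,v)=\{j\in\mathrm{Ap}(w,v)\mid\Phi_{v_{[0,j-1]}}(u)=u'\}$, $\nu^{\mathrm{ap}}_{u\mapsto u'}(w,v)=\dfrac{\#\mathrm{Ap}_{u\mapsto u'}(w,v)}{|v|-|w|+1}$, $D^{\mathrm{ap}}_u(w,v)=\max_{u',u''\in\mathcal A_\kappa^{\ell-1}}\left|\nu^{\mathrm{ap}}_{u\mapsto u'}(w,v)-\nu^{\mathrm{ap}}_{u\mapsto u''}(w,v)\right|$ and $D^{\mathrm{ap}}(w,v)=\max_{u\in\mathcal A_\kappa^{\ell-1}}D^{\mathrm{ap}}_u(w,v)$. (The expressions in (1) and (2) are defined for $n+1\ge|w|$.) *)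

(* Defs.v *)
(* The positive parameters are encoded by their predecessors: throughout,
   kappa = k.+1 and ell = l.+1.  The alphabet {0, ..., kappa - 1} is 'I_k.+1. *)

From HB Require Import structures.
From mathcomp Require Import all_boot all_order all_algebra.
From mathcomp Require Import all_classical all_reals all_analysis.

Set Implicit Arguments.
Unset Strict Implicit.
Unset Printing Implicit Defensive.

Import Order.TTheory GRing.Theory Num.Theory.
Import numFieldNormedType.Exports.

Local Open Scope classical_set_scope.
Local Open Scope ring_scope.

HB.instance Definition _ (n : nat) := hasNbhs.Build 'I_n principal_filter.
HB.instance Definition _ (n : nat) := Discrete_ofNbhs.Build 'I_n erefl.
HB.instance Definition _ (n : nat) := isPointed.Build 'I_n.+1 ord0.

Definition config (k : nat) : Type := prod_topology (fun _ : int => 'I_k.+1).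

HB.instance Definition _ (k : nat) := Pointed.on (config k).
HB.instance Definition _ (k : nat) := Nbhs.on (config k).
HB.instance Definition _ (k : nat) := Topological.on (config k).

Definition borel (k : nat) := g_sigma_algebraType (@open (config k)).

Section Words.
Variable k : nat.

(* x_{[n, n + m - 1]} for a sequence x and for a word z; positions outside z
   are read as the letter 0. *)
Definition factor (x : config k) (n : int) (m : nat) : m.-tuple 'I_k.+1 :=
  [tuple x (n + (i : nat)%:Z) | i < m].

Definition wfactor (z : seq 'I_k.+1) (n m : nat) : m.-tuple 'I_k.+1 :=
  [tuple nth ord0 z (n + i)%N | i < m].

Definition language (Y : set (config k)) : set (seq 'I_k.+1) :=
  [set w | exists2 y, Y y & exists n : int, w = factor y n (size w)].

Definition cylinder (w : seq 'I_k.+1) : set (config k) :=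
  [set x | forall i : nat, (i < size w)%N -> x i%:Z = nth ord0 w i].

End Words.

Section Dynamics.
Variables (R : realType) (k : nat).
Implicit Types Y : set (config k).

Definition shift (x : config k) : config k := fun n => x (n + 1).

Definition orbit (x : config k) : set (config k) :=
  [set z | exists m : int, z = fun n => x (n + m)].

Definition subshift Y : Prop := closed Y /\ shift @` Y = Y.

Definition minimal Y : Prop := forall x, Y x -> Y `<=` closure (orbit x).

(* Borel probability measures on the closed set Y are identified with Borel
   probability measures on the full shift that give Y mass 1. *)
Definition invariant_measure Y (mu : probability (borel k) R) : Prop :=
  mu Y = 1%E /\
  forall B : set (borel k), measurable B -> mu (shift @^-1` B) = mu B.

(* Measures are compared on measurable sets only: the value of a [probability]
   at a non-measurable set is not meaningful. *)
Definition uniquely_ergodic Y : Prop :=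
  exists2 mu : probability (borel k) R, invariant_measure Y mu &
    forall nu : probability (borel k) R, invariant_measure Y nu ->
      forall B : set (borel k), measurable B -> nu B = mu B.

Definition strictly_ergodic Y : Prop :=
  [/\ subshift Y, minimal Y & uniquely_ergodic Y].

End Dynamics.

Definition block_code (k l : nat) := {ffun l.+1.-tuple 'I_k.+1 -> 'I_k.+1}.

Section BlockCodes.
Variables (k l : nat) (h : block_code k l).

Definition eta (x : config k) : config k := fun n => h (factor x n l.+1).

Definition permutative : Prop := forall u : l.-tuple 'I_k.+1,
  bijective (fun a => h [tuple of rcons u a]) /\
  bijective (fun a => h [tuple of a :: u]).

Definition is_xi (u : l.-tuple 'I_k.+1) (w : seq 'I_k.+1)
    (z : (size w + l).-tuple 'I_k.+1) : bool :=
  (take l z == u) &&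
  [forall n : 'I_(size w), h (wfactor z n l.+1) == nth ord0 w n].

(* The default value is only reached when h is not permutative. *)
Definition xi (u : l.-tuple 'I_k.+1) (w : seq 'I_k.+1) :
    (size w + l).-tuple 'I_k.+1 :=
  odflt [tuple of nseq (size w + l) ord0] [pick z | is_xi u z].

Definition Phi (w : seq 'I_k.+1) (u : l.-tuple 'I_k.+1) : l.-tuple 'I_k.+1 :=
  wfactor (xi u w) (size w) l.

(* Meaningful when size w <= size v, as are the definitions built on it. *)
Definition Ap (w v : seq 'I_k.+1) : {set 'I_(size v - size w).+1} :=
  [set j : 'I_(size v - size w).+1 | take (size w) (drop j v) == w].

Definition Ap_to (u u' : l.-tuple 'I_k.+1) (w v : seq 'I_k.+1) :
    {set 'I_(size v - size w).+1} :=
  [set j in Ap w v | Phi (take j v) u == u'].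

End BlockCodes.

(* Maximum of F over I, where i0 : I witnesses that I is nonempty. *)
Definition fmax (R : realType) (I : finType) (i0 : I) (F : I -> R) : R :=
  \big[Num.max/F i0]_(i : I) F i.

Section Discrepancy.
Variables (R : realType) (k l : nat) (h : block_code k l).

Definition nu_ap (u u' : l.-tuple 'I_k.+1) (w v : seq 'I_k.+1) : R :=
  #|Ap_to h u u' w v|%:R / (size v - size w).+1%:R.

Definition zero_word : l.-tuple 'I_k.+1 := [tuple of nseq l ord0].

Definition D_ap_at (u : l.-tuple 'I_k.+1) (w v : seq 'I_k.+1) : R :=
  fmax (zero_word, zero_word)
    (fun p => `| nu_ap u p.1 w v - nu_ap u p.2 w v |).

Definition D_ap (w v : seq 'I_k.+1) : R :=
  fmax zero_word (fun u => D_ap_at u w v).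

End Discrepancy.

Section Conditions.
Variables (R : realType) (k l : nat) (h : block_code k l).

(* The index i ranges over {1, 2, ...}.  The suprema are over bounded sets of
   reals, and the finitely many n with n.+1 < size w do not affect the limit. *)
Definition equidistributed (y : config k) (w : seq 'I_k.+1) : Prop :=
  (fun n : nat => sup [set D_ap R h w (factor y i%:Z n.+1) |
                       i in [set i : nat | (0 < i)%N]]) @ \oo --> (0 : R).

Definition uniform_frequency (mu : probability (borel k) R)
    (y : config k) (w : seq 'I_k.+1) : Prop :=
  (fun n : nat =>
     sup [set fmax (zero_word k l, zero_word k l)
                (fun p => nu_ap R h p.1 p.2 w (factor y i%:Z n.+1)
                          - fine (mu (cylinder w)) / k.+1%:R ^+ l) |
          i in [set i : nat | (0 < i)%N]]) @ \oo --> (0 : R).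

End Conditions.

(* Main.v *)
From HB Require Import structures.
Require Import Defs.
From mathcomp Require Import all_boot all_order all_algebra.
From mathcomp Require Import all_classical all_reals all_analysis.
From mathcomp Require Import finmap zify lra.
Import Defs.

(** The system X is a finite extension of Y.  Reading x in X through the pair
    (eta x, x_[0, l-1]) identifies X with Y x A^l: given y and u there is
    exactly one x with image y and window u at 0 ([eta_section],
    [eta_window_inj]), and as the window slides along x it moves by the prefix
    permutations Phi of the words of y ([PhiE]).  Consequently the apparition
    frequency nu_(u -> u')(w, y_[i, i+n]) is nothing but the ergodic average,
    along the orbit of the preimage x of sigma^i y with window u, of the
    indicator of
      C(w, u') = { x | x_[0, l-1] = u' and eta x in [w] }
    ([nu_apE]).  The translates of the sets C(w, u') are the cylinders of the
    words with at least l letters, so both conditions are about uniform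
    convergence of the averages of cylinders of X, and the theorem reduces to
    the classical relation between unique ergodicity and uniform convergence of
    ergodic averages.

    That relation is [uniform_avg]: on a uniquely ergodic subshift the averages
    of a clopen set B converge to its measure uniformly.  Otherwise there are
    averages over arbitrarily long orbit segments which stay away from the
    measure of B; taking the limit of the averages of every set along an
    ultrafilter gives a shift-invariant finitely additive probability, whose
    restriction to clopen sets extends to a Borel measure because a countable
    union of disjoint clopen sets can only be compact if almost all of them are
    empty ([extend_local], [limit_measure]).  This limit is a second invariant
    measure.

    Two counting identities link the frequencies to mu.  Summed over the end
    window u', nu_(u -> u') gives the frequency of w in y ([sum_nu_ap]), which
    tends uniformly to mu[w]; with K = kappa^(ell-1), all the K summands are
    therefore close to mu[w]/K as soon as they are close to each other
    ([spread_close]), or as soon as none is much larger than mu[w]/K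
    ([upper_close]).  This is the equivalence of [equidistributed] and
    [uniform_frequency], both being equivalent to uniform convergence of
    nu_(u -> u')(w, .) to mu[w]/K ([uniform_nu]).  Summed over the starting
    window u, the frequencies also give the frequency of w ([sum_start_avg]),
    because the prefix permutations are permutations.  So if X is uniquely
    ergodic, its measure gives C(w, u') the mass mu[w]/K ([lifted_measure]),
    and [uniform_avg] on X yields equidistribution for every y.

    Conversely, if one y is equidistributed, the minimality of Y makes every
    word of every point of Y occur in y, and the frequencies depend on the word
    alone: the averages of C(w, u') converge to mu[w]/K uniformly on X
    ([uniform_lift_avg]).  Integrating, every invariant measure of X gives
    C(w, u') this mass, whence uniqueness ([uniquely_ergodic_lift]); as
    mu[w] > 0 for every word of Y, every orbit of X visits every C(w, u'),
    whence minimality ([minimal_lift]). *)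

Set Implicit Arguments.
Unset Strict Implicit.
Unset Printing Implicit Defensive.

Import Order.TTheory GRing.Theory Num.Theory.
Import numFieldNormedType.Exports.

Local Open Scope classical_set_scope.
Local Open Scope ring_scope.

(** * Clopen sets of the full shift *)

Section Topology.
Variable k : nat.
Implicit Types (x z : config k) (A B : set (config k)).

Definition agree (n : nat) x z := forall i : int, (`|i| <= n)%N -> x i = z i.

(** The clopen sets: by compactness, membership in a clopen set depends on
    finitely many coordinates only. *)
Definition local B := exists n, forall x z, agree n x z -> B x -> B z.

Lemma agree_sym n x z : agree n x z -> agree n z x.
Proof. by move=> H i /H. Qed.

Lemma agreeW m n x z : (m <= n)%N -> agree n x z -> agree m x z.
Proof. by move=> mn H i im; apply: H; apply: leq_trans mn. Qed.

Lemma agree_trans n x y z : agree n x y -> agree n y z -> agree n x z.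
Proof. by move=> H1 H2 i im; rewrite H1 ?H2. Qed.

Lemma local0 : local set0. Proof. by exists 0%N. Qed.

Lemma localU : setU_closed local.
Proof.
move=> A B [n nA] [m mB]; exists (maxn n m) => x z xz [Ax|Bx]; [left|right].
- by apply: nA Ax; apply: agreeW xz; rewrite leq_maxl.
- by apply: mB Bx; apply: agreeW xz; rewrite leq_maxr.
Qed.

Lemma localC : setC_closed local.
Proof. by move=> A [n nA]; exists n => x z /agree_sym xz + Az; apply; exact: nA Az. Qed.

Lemma localT : local setT. Proof. by exists 0%N. Qed.

Lemma localI A B : local A -> local B -> local (A `&` B).
Proof.
by move=> lA lB; rewrite -[A]setCK -[B]setCK -setCU; apply/localC/localU;
  apply: localC.
Qed.

Lemma nbhs_coord x (i : int) : nbhs x [set z | z i = x i].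
Proof.
have := @proj_continuous int (fun _ => 'I_k.+1) i x [set x i].
by apply; exact/principal_filterP.
Qed.

Lemma nbhs_agree x n : nbhs x [set z | agree n x z].
Proof.
elim: n => [|n IHn].
  apply: filterS (nbhs_coord x 0) => z /= zx i; rewrite leqn0 absz_eq0 => /eqP ->.
  by [].
apply: filterS (filterI IHn (filterI (nbhs_coord x n.+1%:Z)
  (nbhs_coord x (- n.+1%:Z)))) => z [zx [zp zn]] i iN /=.
have [/zx//|ni] := leqP `|i|%N n.
have [->|->] : i = n.+1%:Z \/ i = - n.+1%:Z by lia.
- by [].
- by [].
Qed.

(** The sets of points which agree with x on a growing window generate a filter
    which converges to x, coordinate by coordinate. *)
Lemma agree_nbhs x A : nbhs x A -> exists n, [set z | agree n x z] `<=` A.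
Proof.
pose F : set_system (config k) := filter_from setT (fun n => [set z | agree n x z]).
have FF : Filter F.
  apply: filter_fromT_filter; first by exists 0%N.
  move=> i j; exists (maxn i j) => z xz; split; apply: agreeW xz;
  by rewrite (leq_maxl, leq_maxr).
suff Fx : F --> x by move=> /Fx -[n _ nA]; exists n.
apply/cvg_sup => i U [V] [[W] oW <-] WfN WU.
exists `|i|%N => // z xz; apply: WU; rewrite /proj/= in WfN *.
by rewrite -xz.
Qed.

Lemma local_open A : local A -> open A.
Proof.
move=> [n nA]; rewrite openE => x Ax; apply: filterS (nbhs_agree x n) => z xz.
exact: nA Ax.
Qed.

Lemma local_closed A : local A -> closed A.
Proof. by move=> /localC/local_open; rewrite openC. Qed.

Lemma config_compact : compact [set: config k].
Proof.
have := @tychonoff int (fun _ => 'I_k.+1) (fun _ => setT).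
rewrite (_ : [set f | _] = setT); last by rewrite -subTset => x _ i.
by apply=> i; apply: finite_compact; exact: finite_finset.
Qed.

(** The n-th member collects the points all of whose neighbours on the window
    of radius n lie in A; this makes the union increasing and countable
    without enumerating cylinders. *)
Lemma open_bigcup_local A : open A ->
  exists2 F : nat -> set (config k), (forall n, local (F n)) & A = \bigcup_n F n.
Proof.
move=> oA; exists (fun n => [set x | [set z | agree n x z] `<=` A]).
  move=> n; exists n => x z xz xA y zy; apply: xA; exact: agree_trans zy.
rewrite eqEsubset; split=> [x Ax|x [n _ /=]]; last by apply => i.
by have [n nA] := agree_nbhs (open_nbhs_nbhs (conj oA Ax)); exists n.
Qed.

(** Compactness of the full shift, in the form which makes finitely additive
    set functions on clopen sets countably additive. *)
Lemma local_finite_cover (F : nat -> set (config k)) A :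
  local A -> (forall n, local (F n)) -> A `<=` \bigcup_n F n ->
  exists N, A `<=` \bigcup_(n < N) F n.
Proof.
move=> lA lF AF.
have : compact A by apply: (subclosed_compact _ config_compact) => //; apply: local_closed.
rewrite compact_cover => /(_ nat setT F) [n _||D _ AD]; first exact: local_open.
  by move=> x /AF [n _ Fn]; exists n.
exists (\max_(i <- enum_fset D) i).+1 => x /AD [i /= iD Fi]; exists i => //=.
by rewrite ltnS; apply: (@leq_bigmax_seq _ _ xpredT id).
Qed.

End Topology.

(** * From finitely additive probabilities on clopen sets to Borel measures *)

Lemma measurable_local k (A : set (borel k)) : local A -> measurable A.
Proof. by move=> /local_open oA; apply: sub_sigma_algebra. Qed.

Lemma measurable_closed k (A : set (borel k)) : closed (A : set (config k)) -> measurable A.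
Proof.
move=> cA; rewrite -[A]setCK; apply: measurableC.
by apply: sub_sigma_algebra; rewrite /= openC.
Qed.

Lemma g_sigma_local k : <<s @local k >> = <<s @open (config k) >>.
Proof.
rewrite eqEsubset; split; apply: smallest_sub; try exact: smallest_sigma_algebra.
  by move=> A /local_open; exact: sub_sigma_algebra.
move=> A /open_bigcup_local [F lF ->].
by apply: sigma_algebra_bigcup => n; apply: sub_sigma_algebra.
Qed.

(** Clopen sets form a pi-system, and they generate the Borel sets because every
    open set is a countable union of them. *)
Lemma eq_prob_local (R : realType) k (p q : {measure set (borel k) -> \bar R}) :
  p setT = 1%E ->
  (forall A, local A -> p A = q A) -> forall A, measurable A -> p A = q A.
Proof.
move=> p1 pq A mA.
apply: (@g_sigma_algebra_measure_unique _ R (borel k) (@local k) _ (fun=> setT)) => //.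
- by move=> B; exact: measurable_local.
- by move=> _; exact: localT.
- by rewrite -subTset => x _; exists 0%N.
- by move=> B C; exact: localI.
- by move=> n; rewrite p1 ltry.
- by rewrite g_sigma_local.
Qed.

Definition local_display : measure_display.
Proof. exact: default_measure_display. Qed.

(** A copy of the full shift which carries the algebra of clopen sets, as the
    Caratheodory extension starts from a type with such an algebra. *)
Definition clopens (k : nat) : Type := config k.
HB.instance Definition _ (k : nat) := Pointed.on (clopens k).
HB.instance Definition _ (k : nat) := @isAlgebraOfSets.Build local_display
  (clopens k) (@local k) (@local0 k) (@localU k) (@localC k).

Section Extension.
Variables (R : realType) (k : nat) (lam : set (config k) -> R).
Hypothesis lam_ge0 : forall A, 0 <= lam A.
Hypothesis lamT : lam setT = 1.
Hypothesis lamU : forall A B, A `&` B = set0 -> lam (A `|` B) = lam A + lam B.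

Definition lamE (A : set (clopens k)) : \bar R := (lam A)%:E.

Let lam0 : lam set0 = 0.
Proof. by have := lamU (setI0 set0); rewrite setU0 => /eqP; rewrite -subr_eq0 => /eqP; lra. Qed.

Let lamE0 : lamE set0 = 0%E.
Proof. by rewrite /lamE lam0. Qed.

Let lamE_ge0 A : (0 <= lamE A)%E.
Proof. by rewrite lee_fin. Qed.

Let lam_bigcup (F : nat -> set (config k)) n : trivIset setT F ->
  lam (\bigcup_(i < n) F i) = \sum_(i < n) lam (F i).
Proof.
move=> tF; elim: n => [|n IHn]; first by rewrite big_ord0 bigcup_mkord big_ord0 lam0.
rewrite bigcup_mkord big_ord_recr /= -bigcup_mkord big_ord_recr /= lamU ?IHn//.
apply/seteqP; split=> // x [[i /= ni Fi] Fn].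
by have := tF i n I I (ex_intro _ x (conj Fi Fn)) => ein; rewrite ein ltnn in ni.
Qed.

Let lamE_semi_sigma_additive : semi_sigma_additive lamE.
Proof.
move=> F lF tF lUF; have [N FN] := local_finite_cover lUF lF (@subset_refl _ _).
(* The sum of the first n masses is already the total for n >= N, since the
   first N members cover the union. *)
apply: cvg_near_cst; near=> n; rewrite /lamE sumEFin big_mkord -lam_bigcup//.
congr ((lam _)%:E); apply/seteqP; split=> x; last by move=> /FN [i /= iN Fi];
  exists i => //=; apply: leq_trans iN _; near: n; exact: nbhs_infty_ge.
by move=> [i _ Fi]; exists i.
Unshelve. all: by end_near. Qed.

HB.instance Definition _ := isMeasure.Build local_display (clopens k) R lamE
  lamE0 lamE_ge0 lamE_semi_sigma_additive.

Let to_borel (x : g_sigma_algebraType (@measurable _ (clopens k))) : borel k := x.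

Let measurable_to_borel : measurable_fun setT to_borel.
Proof.
move=> _ A mA; rewrite setTI (_ : to_borel @^-1` A = A)//.
by move: mA; rewrite /measurable/= -g_sigma_local.
Qed.

(** Caratheodory extension.  Countable additivity on clopen sets is automatic:
    a clopen union of disjoint clopen sets is compact, so that it has only
    finitely many nonempty members. *)
Lemma extend_local :
  exists p : probability (borel k) R, forall A, local A -> p A = (lam A)%:E.
Proof.
pose pm : {measure set (borel k) -> \bar R} :=
  measure_function_pushforward__canonical__measure_function_Measure
    (measure_extension lamE) measurable_to_borel.
have pmE A : local A -> pm A = (lam A)%:E.
  by move=> lA; rewrite /= /pushforward /measure_extension measurable_mu_extE.
have pm1 : pm setT = 1%E by rewrite pmE ?lamT//; exact: localT.
pose P := Measure_isProbability.Build _ (borel k) R pm pm1.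
pose p : probability (borel k) R := HB.pack_for (probability (borel k) R) (Measure.sort pm) P.
by exists p.
Qed.

End Extension.

(** * Translations, ergodic averages and invariant measures *)

Section Translations.
Variable k : nat.
Implicit Types (x z : config k) (A B Z : set (config k)).

Definition translate (m : int) x : config k := fun n => x (n + m).

Lemma translateD m n x : translate m (translate n x) = translate (m + n) x.
Proof. by apply: funext => i; rewrite /translate addrA. Qed.

Lemma translate0 x : translate 0 x = x.
Proof. by apply: funext => i; rewrite /translate addr0. Qed.

Lemma shiftE x : shift x = translate 1 x. Proof. by []. Qed.

Lemma local_translate m A : local A -> local (translate m @^-1` A).
Proof.
move=> [n nA]; exists (n + `|m|)%N => x z xz; apply: nA => i iN.
by apply: xz; lia.
Qed.

Lemma subshift_translate Z m x : subshift Z -> Z x -> Z (translate m x).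
Proof.
move=> [_ ZE].
have Zs z : Z z -> Z (translate 1 z) by move=> Zz; rewrite -ZE; exists z.
have ZV z : Z z -> Z (translate (-1) z).
  rewrite -{1}ZE => -[t Zt <-].
  by rewrite shiftE translateD addrC subrr translate0.
move=> Zx; case: m => n.
  elim: n => [|n IHn]; first by rewrite translate0.
  by rewrite (_ : Posz n.+1 = 1 + n%:Z)// -translateD; apply: Zs.
elim: n => [|n IHn]; first exact: ZV.
rewrite (_ : Negz n.+1 = -1 + Negz n) -?translateD; first exact: ZV.
by rewrite !NegzE; lia.
Qed.

Lemma measurable_translate m :
  measurable_fun setT (translate m : borel k -> borel k).
Proof.
apply: (@measurability _ _ (borel k) (borel k) setT _ (@local k)).
  by rewrite /measurable/= g_sigma_local.
move=> _ [A lA <-]; rewrite setTI.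
by apply: measurable_local; exact: local_translate.
Qed.

End Translations.

Section Averages.
Variables (R : realType) (k : nat).
Implicit Types (x z : config k) (A B Z : set (config k)).

Definition avg (N : nat) B x : R :=
  (\sum_(j < N) (translate j%:Z x \in B)%:R) / N%:R.

Lemma avg_ge0 N B x : 0 <= avg N B x.
Proof. by apply: divr_ge0 => //; apply: sumr_ge0 => i _; rewrite ler0n. Qed.

Lemma avg_le1 N B x : avg N B x <= 1.
Proof.
case: N => [|N]; first by rewrite /avg big_ord0 mul0r ler01.
rewrite /avg ler_pdivrMr ?ltr0n// mul1r.
apply: (@le_trans _ _ (\sum_(j < N.+1) 1)); last by rewrite sumr_const card_ord.
by apply: ler_sum => i _; case: (_ \in B); rewrite ?ler01.
Qed.

Lemma avgU N A B x : A `&` B = set0 -> avg N (A `|` B) x = avg N A x + avg N B x.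
Proof.
move=> AB; rewrite /avg -mulrDl -big_split/=; congr (_ / _).
apply: eq_bigr => i _; rewrite in_setU -natrD.
case: (boolP (_ \in A)) => // /set_mem Ai; case: (boolP (_ \in B)) => // /set_mem Bi.
by have : set0 (translate (Posz i) x) by rewrite -AB.
Qed.

Lemma avgT N x : (0 < N)%N -> avg N setT x = 1.
Proof.
move=> N0; rewrite /avg (eq_bigr (fun=> 1)); last by move=> i _; rewrite in_setT.
by rewrite sumr_const card_ord divff// pnatr_eq0 -lt0n.
Qed.

(** The difference of the two sums telescopes to a difference of two terms. *)
Lemma avg_shift N A x : `|avg N (@shift k @^-1` A) x - avg N A x| <= N%:R^-1.
Proof.
rewrite /avg -mulrBl normrM [X in _ * X]ger0_norm ?invr_ge0 ?ler0n//.
rewrite -[leRHS]mul1r ler_wpM2r ?invr_ge0//.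
pose f j : R := (translate j%:Z x \in A)%:R.
rewrite (eq_bigr (fun j : 'I_N => f j.+1)); last first.
  move=> j _; rewrite /f; congr (_%:R); congr nat_of_bool.
  by apply/idP/idP => /set_mem H; apply/mem_set; move: H;
    rewrite /preimage/= shiftE translateD.
have -> : \sum_(j < N) f j.+1 - \sum_(j < N) f j = f N - f 0%N.
  have Hl : \sum_(j < N.+1) f j = f 0%N + \sum_(j < N) f j.+1 by rewrite big_ord_recl.
  have Hr : \sum_(j < N.+1) f j = \sum_(j < N) f j + f N by rewrite big_ord_recr.
  by rewrite Hl in Hr; lra.
by rewrite /f; case: (_ \in A); case: (_ \in A);
  rewrite ?subrr ?subr0 ?sub0r ?normrN ?normr1 ?normr0.
Qed.

Lemma avg_disjoint N A Z x :
  subshift Z -> Z x -> A `&` Z = set0 -> avg N A x = 0.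
Proof.
move=> sZ Zx AZ; rewrite /avg big1 ?mul0r// => j _.
case: (boolP (_ \in A)) => // /set_mem Aj.
by have : set0 (translate (Posz j) x) by rewrite -AZ; split=> //; exact: subshift_translate.
Qed.

(** A cluster point along an ultrafilter is a limit. *)
Lemma ultra_cvg_bounded (U : set_system nat) (u : nat -> R) :
  UltraFilter U -> (forall i, 0 <= u i <= 1) -> exists l : R, u @ U --> l.
Proof.
move=> UU u01; have := @segment_compact R 0 1 (u @ U) _.
case=> [|l [_ lu]].
  by apply: (@filterE _ U) => i; rewrite /= in_itv/=; exact: u01.
exists l => V Vl; have [//|UV] := in_ultra_setVsetC (u @^-1` V) UU.
by have [t [/= ]] := lu (~` V) V UV Vl.
Qed.

Lemma invariant_translate Z (p : probability (borel k) R) (B : set (borel k)) j :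
  invariant_measure Z p -> measurable B -> p (translate j%:Z @^-1` B) = p B.
Proof.
move=> [_ pinv] mB; elim: j => [|j IHj].
  by congr (p _); apply/seteqP; split=> x /=; rewrite translate0.
have mj : measurable (translate j%:Z @^-1` B : set (borel k)).
  by rewrite -[X in measurable X]setTI; apply: measurable_translate.
rewrite -IHj -[RHS]pinv//; congr (p _).
by apply/seteqP; split=> x /=; rewrite /preimage/= shiftE translateD -PoszD addn1.
Qed.

Lemma invariant_null Z (p : probability (borel k) R) (A : set (borel k)) :
  closed Z -> invariant_measure Z p -> measurable A -> A `&` Z = set0 -> p A = 0%E.
Proof.
move=> cZ [pZ _] mA AZ.
have mZ : measurable (Z : set (borel k)) by exact: measurable_closed.
have pZC : p (~` (Z : set (borel k))) = 0%E by rewrite probability_setC// pZ subee.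
apply: (subset_measure0 _ _ _ pZC) => //; first exact: measurableC.
by move=> x Ax Zx; have : set0 x by rewrite -AZ.
Qed.

(** Integrate the average of B over Z: by invariance each of its terms has
    integral p(B), and p is carried by Z, where the bound holds. *)
Lemma invariant_avg Z (p : probability (borel k) R) (B : set (borel k)) N (c e : R) :
  subshift Z -> invariant_measure Z p -> measurable B -> (0 < N)%N ->
  (forall x, Z x -> `|avg N B x - c| <= e) -> `|fine (p B) - c| <= e.
Proof.
move=> [cZ _] pinv mB N0 avgP.
have mZ : measurable (Z : set (borel k)) by exact: measurable_closed.
have mBj (j : nat) : measurable (translate j%:Z @^-1` B : set (borel k)).
  by rewrite -[X in measurable X]setTI; apply: measurable_translate.
pose f (x : borel k) : R := \sum_(j < N) (\1_(translate j%:Z @^-1` B) x).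
have fE x : f x = N%:R * avg N B x.
  rewrite /f /avg mulrC divfK ?pnatr_eq0 -?lt0n//.
have pZB (A : set (borel k)) : measurable A -> p (A `&` Z) = p A.
  move=> mA; rewrite (measureDI p mA mZ) [X in (X + _)%E](_ : _ = 0%E) ?add0e//.
  apply: (invariant_null cZ pinv); first exact: measurableD.
  by apply/seteqP; split=> // x [[_ nZ]].
have intj (j : nat) :
    p.-integrable Z (fun x : borel k => (\1_(translate j%:Z @^-1` B) x)%:E).
  exact/(integrableS measurableT mZ)/integrable_indic.
have pB : p B = (fine (p B))%:E by rewrite fineK// fin_num_measure.
have intfE : (fun x => (f x)%:E) =
    (fun x => \sum_(j < N) (\1_(translate j%:Z @^-1` B) x)%:E)%E.
  by apply: funext => x; rewrite sumEFin.
have intf : (\int[p]_(x in Z) (f x)%:E = (N%:R * fine (p B))%:E)%E.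
  rewrite intfE integral_sum//.
  rewrite (eq_bigr (fun=> p B)); last first.
    move=> j _; transitivity (p ((translate (Posz j) @^-1` B : set (borel k)) `&` Z)).
      exact: integral_indic.
    rewrite pZB//.
    exact: invariant_translate pinv mB.
  by rewrite pB sumEFin sumr_const card_ord mulr_natl.
have fint : p.-integrable Z (fun x => (f x)%:E).
  by rewrite intfE; apply: integrable_sum => // j; exact: intj.
have cint c' : p.-integrable Z (EFin \o cst c').
  exact: finite_measure_integrable_cst.
have intc c' : (\int[p]_(x in Z) (EFin \o cst c') x = c'%:E :> \bar R)%E.
  transitivity (c'%:E * p Z)%E; first exact (integral_cst p mZ c'%:E).
  by rewrite (proj1 pinv) mule1.
have N0' : (0 : R) < N%:R by rewrite ltr0n.
rewrite ler_norml; apply/andP; split.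
- have := le_integral mZ (cint (N%:R * (c - e))) fint.
  rewrite intc intf lee_fin (ler_pM2l N0')//.
  suff H : {in Z, forall x : borel k, ((EFin \o cst (N%:R * (c - e))%R) x <= (f x)%:E)%E}.
    by move=> /(_ H); lra.
  move=> x /set_mem /avgP; rewrite ler_norml => /andP[H _].
  by rewrite /= lee_fin fE (ler_pM2l N0')//; lra.
- have := le_integral mZ fint (cint (N%:R * (c + e))).
  rewrite intc intf lee_fin (ler_pM2l N0')//.
  suff H : {in Z, forall x : borel k, ((f x)%:E <= (EFin \o cst (N%:R * (c + e))%R) x)%E}.
    by move=> /(_ H); lra.
  move=> x /set_mem /avgP; rewrite ler_norml => /andP[_ H].
  by rewrite /= lee_fin fE (ler_pM2l N0')//; lra.
Qed.

End Averages.

(** * Unique ergodicity and uniform convergence of averages *)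

Section Ergodic.
Variables (R : realType) (k : nat).
Implicit Types (x z : config k) (A B Z : set (config k)).

Lemma invariant_measure_local Z (p : probability (borel k) R) :
  closed Z ->
  (forall A, local A -> p (@shift k @^-1` A) = p A) ->
  (forall A, local A -> A `&` Z = set0 -> p A = 0%E) ->
  invariant_measure Z p.
Proof.
move=> cZ pinv p0; split; last first.
  move=> B mB.
  pose q : {measure set (borel k) -> \bar R} :=
    measure_function_pushforward__canonical__measure_function_Measure
      p (@measurable_translate k 1).
  symmetry; apply: (@eq_prob_local R k p q) => //; first exact: probability_setT.
  by move=> A lA; symmetry; exact: pinv.
have mZ : measurable (Z : set (borel k)) by exact: measurable_closed.
have pZC : p (~` (Z : set (borel k))) = 0%E.
  have oZ : open (~` Z) by exact: closed_openC.
  have [F lF ZF] := open_bigcup_local oZ.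
  have mF n : measurable (F n : set (borel k)) by exact: measurable_local.
  rewrite ZF; apply: measure_negligible; first exact: bigcupT_measurable.
  apply: negligible_bigcup => n; apply/negligibleP; first exact: mF.
  apply: p0 => //; apply/seteqP; split=> // x [Fx Zx].
  suff : (~` Z) x by [].
  by rewrite ZF; exists n.
have : (p Z + p (~` (Z : set (borel k))) = 1)%E.
  rewrite -measureU//; [|exact: measurableC|by rewrite setICr].
  by rewrite setUCr; exact: probability_setT.
by rewrite pZC adde0.
Qed.

(** Krylov-Bogolyubov.  Limits along an ultrafilter exist for all sets
    simultaneously, which replaces the extraction of a diagonal subsequence;
    the lengths N_ i tend to infinity, so that the limit is shift-invariant. *)
Lemma limit_measure Z (N_ : nat -> nat) (x_ : nat -> config k) :
  subshift Z -> (forall i, Z (x_ i)) -> (forall i, (i < N_ i)%N) ->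
  exists U : set_system nat, exists p : probability (borel k) R,
    [/\ ProperFilter U, \oo `<=` U, invariant_measure Z p &
     forall B, local B -> avg R (N_ i) B (x_ i) @[i --> U] --> fine (p B)].
Proof.
move=> sZ Zx iN; have [U [UU oU]] := ultraFilterLemma eventually_filter.
have PU : ProperFilter U by exact: ultra_proper.
have lim_ex A : {l : R | avg R (N_ i) A (x_ i) @[i --> U] --> l}.
  apply: cid; apply: ultra_cvg_bounded => i.
  by rewrite avg_ge0 avg_le1.
pose lam A := sval (lim_ex A).
have lamP A : avg R (N_ i) A (x_ i) @[i --> U] --> lam A := svalP (lim_ex A).
have lam_eq A (l : R) : avg R (N_ i) A (x_ i) @[i --> U] --> l -> lam A = l.
  exact: norm_cvg_unique (lamP A).
have lam_ge0 A : 0 <= lam A.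
  apply: (cvgr_to_ge (lamP A)).
  by apply: filterE => i; exact: avg_ge0.
have lamT : lam setT = 1.
  apply: lam_eq; apply: cvg_near_cst; apply: filterE => i.
  by apply: avgT; exact: leq_ltn_trans (iN i).
have lamU A B : A `&` B = set0 -> lam (A `|` B) = lam A + lam B.
  move=> AB; apply: lam_eq.
  under eq_cvg do rewrite (avgU _ _ _ AB).
  exact: cvgD (lamP A) (lamP B).
have [p pE] := extend_local lam_ge0 lamT lamU.
exists U, p; split=> //; last first.
  by move=> B lB; rewrite pE//; exact: lamP.
apply: invariant_measure_local; first by case: sZ.
- move=> A lA; rewrite !pE//; last exact: (local_translate 1 lA).
  congr (_%:E); apply: lam_eq.
  rewrite -[lam A]addr0.
  rewrite (_ : (fun _ => _) = (fun i => avg R (N_ i) A (x_ i) +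
     (avg R (N_ i) (@shift k @^-1` A) (x_ i) - avg R (N_ i) A (x_ i)))); last first.
    by apply: funext => i; rewrite addrC subrK.
  apply: cvgD; first exact: lamP.
  apply: norm_cvg0; apply: (@squeeze_cvgr _ U _ R (fun=> 0) harmonic).
  - apply: filterE => i; rewrite normr_ge0/=.
    apply: le_trans (avg_shift _ _ _ _) _.
    by rewrite /harmonic lef_pV2 ?posrE ?ltr0n ?ler_nat//; exact: leq_ltn_trans (iN i).
  - exact: cvg_cst.
  - by move=> V /(@cvg_harmonic R); exact: oU.
- move=> A lA AZ; rewrite pE//; congr (_%:E); apply: lam_eq.
  by apply: cvg_near_cst; apply: filterE => i; exact: avg_disjoint sZ (Zx i) AZ.
Qed.

Lemma exists_invariant_measure Z : subshift Z -> Z !=set0 ->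
  exists p : probability (borel k) R, invariant_measure Z p.
Proof.
move=> sZ [x Zx].
by have [U [p [_ _ pinv _]]] := @limit_measure Z S (fun=> x) sZ (fun=> Zx) ltnSn; exists p.
Qed.

(** If the averages at some points stay away from m(B), a limit measure of
    these averages is an invariant measure other than m. *)
Lemma uniform_avg Z (m : probability (borel k) R) B (e : R) :
  subshift Z -> uniquely_ergodic R Z -> invariant_measure Z m -> local B ->
  0 < e ->
  exists N0, forall N x, (N0 <= N)%N -> Z x -> `|avg R N B x - fine (m B)| <= e.
Proof.
move=> sZ [m0 m0inv uniq] minv lB e0; apply/not_existsP => bad.
have ex n : {Nx : nat * config k | [/\ (n < Nx.1)%N, Z Nx.2 &
    e < `|avg R Nx.1 B Nx.2 - fine (m B)|]}.
  apply: cid; move: (bad n.+1) => /existsNP[N /existsNP[x /not_implyP[nN /not_implyP[Zx]]]].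
  by move=> /negP; rewrite -ltNge => H; exists (N, x).
have [U [p [PU oU pinv pB]]] := @limit_measure Z (fun n => (sval (ex n)).1)
  (fun n => (sval (ex n)).2) sZ (fun n => let: And3 _ h _ := svalP (ex n) in h)
  (fun n => let: And3 h _ _ := svalP (ex n) in h).
have mB : measurable (B : set (borel k)) by exact: measurable_local.
have epm : fine (p B) = fine (m B) by rewrite (uniq p)// (uniq m).
have := pB B lB; rewrite epm => /cvgrPdist_lt /(_ e e0) /filter_ex [i].
rewrite distrC; have [_ _] := svalP (ex i).
by move=> /ltW; rewrite leNgt => /negP.
Qed.

End Ergodic.

(** * Permutative block codes *)

Section Factors.
Variable k : nat.
Implicit Types (x y z : config k) (w : seq 'I_k.+1).

Lemma factorP x z (a b : int) m :
  factor x a m = factor z b m <->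
  (forall i : nat, (i < m)%N -> x (a + i%:Z) = z (b + i%:Z)).
Proof.
split=> [E i im|E].
  by have := congr1 (fun t => tnth t (Ordinal im)) E; rewrite !tnth_mktuple.
by apply: eq_from_tnth => i; rewrite !tnth_mktuple E.
Qed.

Lemma nth_factor x (a : int) m i : (i < m)%N -> nth ord0 (factor x a m) i = x (a + i%:Z).
Proof. by move=> im; rewrite -[i]/(val (Ordinal im)) -tnth_nth tnth_mktuple. Qed.

Lemma eq_from_nth_tuple m (s t : m.-tuple 'I_k.+1) :
  (forall i, (i < m)%N -> nth ord0 s i = nth ord0 t i) -> s = t.
Proof. by move=> E; apply: eq_from_tnth => i; rewrite !(tnth_nth ord0) E. Qed.

Lemma factor_rcons x (a : int) m :
  factor x a m.+1 = [tuple of rcons (factor x a m) (x (a + m%:Z))].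
Proof.
apply: eq_from_nth_tuple => i im.
rewrite nth_factor// -[RHS]/(nth ord0 (rcons (factor x a m) (x (a + m%:Z))) i).
rewrite nth_rcons size_tuple; case: ltngtP => [i_m||->//].
  by rewrite nth_factor.
by rewrite ltnNge -ltnS im.
Qed.

Lemma factor_cons x (a : int) m :
  factor x a m.+1 = [tuple of x a :: factor x (a + 1) m].
Proof.
apply: eq_from_nth_tuple => -[|i] im; first by rewrite nth_factor// addr0.
rewrite nth_factor// -[RHS]/(nth ord0 (factor x (a + 1) m) i) nth_factor//.
by congr (x _); lia.
Qed.

Lemma factor_translate x (a c : int) m :
  factor (translate c x) a m = factor x (a + c) m.
Proof. by apply/factorP => i im; rewrite /translate; congr (x _); lia. Qed.

Lemma take_drop_factor x (a : int) (j m n : nat) : (j + m <= n)%N ->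
  take m (drop j (factor x a n)) = factor x (a + j%:Z) m.
Proof.
move=> jmn; apply: (@eq_from_nth _ ord0) => [|i].
  by rewrite size_take_min size_drop !size_tuple; lia.
rewrite size_take_min size_drop size_tuple => im.
rewrite nth_take; last by lia.
rewrite nth_drop !nth_factor; [congr (x _); lia|lia|lia].
Qed.

Lemma cylinderP w y : cylinder w y <-> factor y 0 (size w) = w :> seq _.
Proof.
split=> [wy|E i iw]; last by rewrite -[X in nth _ X]E nth_factor// add0r.
apply: (@eq_from_nth _ ord0) => [|i]; rewrite ?size_tuple// => iw.
by rewrite nth_factor// add0r wy.
Qed.

Lemma cylinder_factorP y z (a : int) m :
  cylinder (factor y a m) z <-> factor z 0 m = factor y a m.
Proof.
split=> [wz|/factorP E i].
  by apply/factorP => i im; rewrite add0r wz ?size_tuple// nth_factor.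
by rewrite size_tuple => im; rewrite nth_factor// -E// add0r.
Qed.

Lemma local_cylinder w : local (cylinder w).
Proof. by exists (size w) => x z xz wx i iw; rewrite -xz ?wx//=; lia. Qed.

End Factors.

Section BlockCode.
Variables (k l : nat) (h : block_code k l).
Implicit Types (x y z : config k) (w : seq 'I_k.+1) (u : l.-tuple 'I_k.+1).

Lemma eta_translate (c : int) x : eta h (translate c x) = translate c (eta h x).
Proof. by apply: funext => n; rewrite /eta factor_translate. Qed.

Lemma agree_eta n x z : agree (n + l) x z -> agree n (eta h x) (eta h z).
Proof. by move=> xz i ni; congr (h _); apply/factorP => j jl; apply: xz; lia. Qed.

Lemma local_eta B : local B -> local (eta h @^-1` B).
Proof. by move=> [n nB]; exists (n + l)%N => x z /agree_eta xz; exact: nB. Qed.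

Lemma subshift_eta Y : subshift Y -> subshift (eta h @^-1` Y).
Proof.
move=> sY; have [cY YE] := sY; split.
  rewrite -openC preimage_setC; move: cY; rewrite -openC.
  move=> /open_bigcup_local [F lF ->]; rewrite preimage_bigcup.
  by apply: bigcup_open => n _; apply: local_open; exact: local_eta.
apply/seteqP; split=> [_ [x Yx <-]|x Yx].
  by rewrite /preimage/= shiftE eta_translate; apply: subshift_translate.
exists (translate (-1) x); last by rewrite shiftE translateD subrr translate0.
by rewrite /preimage/= eta_translate; apply: subshift_translate.
Qed.

Hypothesis hh : permutative h.

Lemma eta_right_determined x z (a b : int) :
  eta h x a = eta h z b -> factor x a l = factor z b l ->
  x (a + l%:Z) = z (b + l%:Z).
Proof.
rewrite /eta !factor_rcons => E F; rewrite F in E.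
by have [/bij_inj/(_ _ _ E)] := hh (factor z b l).
Qed.

Lemma eta_left_determined x z (a b : int) :
  eta h x a = eta h z b -> factor x (a + 1) l = factor z (b + 1) l ->
  x a = z b.
Proof.
rewrite /eta !factor_cons => E F; rewrite F in E.
by have [_ /bij_inj/(_ _ _ E)] := hh (factor z (b + 1) l).
Qed.

(** Right permutativity determines the letters one after the other. *)
Lemma eta_prefix_determined x z (a b : int) m :
  factor x a l = factor z b l ->
  (forall i : nat, (i < m)%N -> eta h x (a + i%:Z) = eta h z (b + i%:Z)) ->
  factor x a (m + l) = factor z b (m + l).
Proof.
move=> F; elim: m => [//|m IHm] E; rewrite addSn !factor_rcons.
have {}IHm : factor x a (m + l) = factor z b (m + l).
  by apply: IHm => i im; apply: E; exact: ltnW.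
suff -> : x (a + (m + l)%:Z) = z (b + (m + l)%:Z) by rewrite IHm.
rewrite !PoszD !addrA; apply: eta_right_determined; first exact: E.
move/factorP: IHm => IHm; apply/factorP => i il.
by rewrite -!addrA -!PoszD; apply: IHm; lia.
Qed.

(** Windows propagate to the right by right permutativity and to the left by
    left permutativity, so that one window determines the point. *)
Lemma eta_window_inj x z (a : int) :
  eta h x = eta h z -> factor x a l = factor z a l -> x = z.
Proof.
move=> E F.
have fwd (b : int) : factor x b l = factor z b l -> factor x (b + 1) l = factor z (b + 1) l.
  move=> Fb; have : factor x b l.+1 = factor z b l.+1.
    by apply: (@eta_prefix_determined x z b b 1) => // i _; rewrite E.
  by rewrite !factor_cons => /(congr1 val)[_ ?]; apply: val_inj.
have bwd (b : int) : factor x (b + 1) l = factor z (b + 1) l -> factor x b l = factor z b l.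
  move=> Fb; have xzb : x b = z b by apply: eta_left_determined => //; rewrite E.
  apply/factorP => -[|i] il; first by rewrite addr0.
  move/factorP: Fb => /(_ i (ltnW il)).
  by rewrite -!addrA.
have Fall (j : int) : factor x (a + j) l = factor z (a + j) l.
  case: j => j.
    elim: j => [|j IHj]; first by rewrite addr0.
    by rewrite (_ : a + j.+1 = a + j%:Z + 1); [exact: fwd|lia].
  elim: j => [|j IHj]; apply: bwd.
    by rewrite (_ : a + Negz 0 + 1 = a)//; lia.
  by rewrite (_ : a + Negz j.+1 + 1 = a + Negz j)//; lia.
apply: funext => n.
have := @eta_right_determined x z (n - l%:Z) (n - l%:Z).
rewrite subrK; apply; first by rewrite E.
by have := Fall (n - l%:Z - a); rewrite (_ : a + _ = n - l%:Z)//; lia.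
Qed.

(** The letter at N + l affects the image at N but not at the positions in
    [-N, N[, and the letter at - N - 1 affects the image at - N - 1 but not at
    the positions in [-N, N]: both image letters can be prescribed
    independently of what has been achieved before. *)
Lemma eta_extend1 y (N : nat) x : exists x',
  [/\ (forall i : int, i != (N + l)%:Z -> i != - (N.+1)%:Z -> x' i = x i),
      eta h x' N%:Z = y N%:Z & eta h x' (- N.+1%:Z) = y (- N.+1%:Z)].
Proof.
have [[f _ fK] _] := hh (factor x N%:Z l).
pose c := f (y N%:Z).
pose x1 : config k := fun i => if i == (N + l)%:Z then c else x i.
have [_ [g _ gK]] := hh (factor x1 (- N.+1%:Z + 1) l).
pose d := g (y (- N.+1%:Z)).
pose x2 : config k := fun i => if i == - N.+1%:Z then d else x1 i.
exists x2; split=> [i iN iN'||].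
- by rewrite /x2 (negbTE iN') /x1 (negbTE iN).
- rewrite /eta factor_rcons -[RHS]fK; congr (h _).
  apply: val_inj; congr rcons.
    congr val; apply/factorP => i il.
    by rewrite /x2 /x1; case: eqP => [|_]; [lia|case: eqP => [|_ //]; lia].
  by rewrite /x2 /x1 -PoszD eqxx; case: eqP => //; lia.
- rewrite /eta factor_cons -[RHS]gK; congr (h _).
  apply: val_inj; congr cons; first by rewrite /x2 eqxx.
  congr val; apply/factorP => i il.
  by rewrite /x2; case: eqP => //; lia.
Qed.

(** Correct the image letter by letter on both sides, starting from any point
    with window u at 0.  Each coordinate is modified finitely often, and the
    eventual values form the required point. *)
Lemma eta_section y u : exists2 x, eta h x = y & factor x 0 l = u.
Proof.
pose ext N x := sval (cid (eta_extend1 y N x)).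
have extP N x := svalP (cid (eta_extend1 y N x)).
pose base : config k := fun i => nth ord0 u `|i|%N.
pose X := fix X N := if N is M.+1 then ext M (X M) else base.
have XS N (i : int) : (`|i| < N)%N -> X N.+1 i = X N i.
  by move=> iN; have [+ _ _] := extP N (X N); apply; apply/eqP; lia.
have XE N M (i : int) : (`|i| < N)%N -> (N <= M)%N -> X M i = X N i.
  move=> iN; elim: M => [|M IHM]; first by rewrite leqn0 => /eqP ->.
  rewrite leq_eqVlt => /predU1P[->//|]; rewrite ltnS => NM.
  by rewrite XS ?IHM//; lia.
have XN N n : (- N%:Z <= n < N%:Z) -> eta h (X N) n = y n.
  elim: N n => [|N IHN] n nN; first by lia.
  have [XSE XN XN'] := extP N (X N).
  have [nN'|] := boolP (- N%:Z <= n < N%:Z).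
    rewrite -(IHN n nN'); congr (h _); apply/factorP => i il.
    by apply: XSE; apply/eqP; lia.
  move=> nN'; have [->|->] : n = N%:Z \/ n = - N.+1%:Z by lia.
  - exact: XN.
  - exact: XN'.
(* Step N modifies the coordinates N + l and - N - 1 only, so that coordinate
   i is final after |i| + 1 steps. *)
pose x : config k := fun i => X (`|i|.+1)%N i.
have xX N (i : int) : (`|i| < N)%N -> x i = X N i by move=> iN; rewrite (XE `|i|.+1 N).
exists x.
  apply: funext => n; rewrite -(XN (`|n| + l).+1 n); last by lia.
  by congr (h _); apply/factorP => i il; apply: xX; lia.
have X0 N (i : nat) : (i < l)%N -> X N i%:Z = nth ord0 u i.
  move=> il; elim: N => [//|N <-].
  by have [+ _ _] := extP N (X N); apply; apply/eqP; lia.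
by apply: eq_from_nth_tuple => i il; rewrite nth_factor// add0r /x X0.
Qed.

(** The word xi is the unique extension of u compatible with w, hence it is
    read off any point x with window u whose image starts with w. *)
Lemma PhiE x u w : factor x 0 l = u ->
  (forall j : nat, (j < size w)%N -> eta h x j%:Z = nth ord0 w j) ->
  Phi h w u = factor x (size w)%:Z l.
Proof.
move=> xu xw; rewrite /Phi /xi.
case: pickP => [z|/(_ (factor x 0 (size w + l)))]; last first.
  move=> /negbT /negP[]; apply/andP; split.
    by rewrite -[val _]drop0 take_drop_factor ?leq_addl// addr0 xu.
  apply/forallP => j; rewrite -xw// /eta; apply/eqP; congr (h _).
  apply: eq_from_tnth => i; rewrite !tnth_mktuple nth_factor ?add0r//.
  by have := ltn_ord i; have := ltn_ord j; lia.
move=> /andP[/eqP zu /forallP zw] /=.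
(* Any sequence which reads z on the right of the origin would do. *)
pose cz : config k := fun i => nth ord0 z `|i|%N.
have wz (n m : nat) : wfactor z n m = factor cz n%:Z m.
  by apply: eq_from_tnth => i; rewrite !tnth_mktuple /cz; congr (nth _ _ _); lia.
have zx : factor cz 0 (size w + l) = factor x 0 (size w + l).
  apply: eta_prefix_determined.
    rewrite xu; apply: eq_from_nth_tuple => i il.
    by rewrite nth_factor// add0r /cz -zu nth_take.
  move=> i iw; rewrite !add0r xw//.
  by have /eqP := zw (Ordinal iw); rewrite /eta -wz.
move/factorP: zx => zx; rewrite wz; apply/factorP => i il.
by have := zx (size w + i)%N; rewrite PoszD !add0r; apply; rewrite ltn_add2l.
Qed.

End BlockCode.

(** * Apparition frequencies as ergodic averages *)

Section Frequencies.
Variables (R : realType) (k l : nat) (h : block_code k l).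
Implicit Types (x y z : config k) (w : seq 'I_k.+1) (u : l.-tuple 'I_k.+1).

(** For permutative codes this is the cylinder of the word xi^u(w). *)
Definition lift_cyl w u : set (config k) :=
  [set x | factor x 0 l = u /\ cylinder w (eta h x)].

Lemma in_lift_cyl w u x :
  (x \in lift_cyl w u) = (factor x 0 l == u) && (eta h x \in cylinder w).
Proof.
apply/idP/idP => [/set_mem[/eqP -> /mem_set ->]//|/andP[/eqP xu /set_mem xw]].
exact/mem_set.
Qed.

Lemma local_lift_cyl w u : local (lift_cyl w u).
Proof.
apply: localI; last exact/local_eta/local_cylinder.
exists l => x z xz <-; apply/factorP => i il.
by rewrite xz//; lia.
Qed.

Lemma nu_ap_ge0 u u' w v : 0 <= nu_ap R h u u' w v.
Proof. by apply: divr_ge0. Qed.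

Lemma nu_ap_le1 u u' w v : nu_ap R h u u' w v <= 1.
Proof.
rewrite /nu_ap ler_pdivrMr ?ltr0n// mul1r ler_nat.
by rewrite -[leqRHS]card_ord max_card.
Qed.

Lemma sum_nu_ap u w v :
  \sum_u' nu_ap R h u u' w v = #|Ap w v|%:R / (size v - size w).+1%:R.
Proof.
rewrite -mulr_suml -natr_sum; congr (_%:R / _).
transitivity (\sum_u' \sum_(j in Ap w v | Phi h (take j v) u == u') 1)%N.
  by apply: eq_bigr => u' _; rewrite -sum1_card; apply: eq_bigl => j; rewrite inE.
symmetry; rewrite -sum1_card.
exact: (@partition_big _ _ _ _ _ _ _
  (fun j : 'I_(size v - size w).+1 => Phi h (take j v) u) xpredT).
Qed.

Lemma card_Ap y n w : (size w <= n)%N ->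
  #|Ap w (factor y 0 n)|%:R / (size (factor y 0 n) - size w).+1%:R =
  avg R (n - size w).+1 (cylinder w) y.
Proof.
move=> wn; rewrite /avg; set v := factor y 0 n.
have -> : #|Ap w v|%:R =
    \sum_(j < (size v - size w).+1) (take (size w) (drop j v) == w)%:R :> R.
  by rewrite -sum1_card natr_sum big_mkcond; apply: eq_bigr => j _;
    rewrite inE; case: (_ == w).
rewrite !size_tuple; congr (_ / _); apply: eq_bigr => j _.
rewrite take_drop_factor ?add0r; last by have := ltn_ord j; lia.
congr (nat_of_bool _)%:R; apply/eqP/idP => [E|/set_mem].
  by apply/mem_set/cylinderP; rewrite factor_translate add0r.
by rewrite cylinderP factor_translate add0r.
Qed.

Hypothesis hh : permutative h.

(** The prefix permutation of y_[0, j-1] sends the window of x at 0 to its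
    window at j, so that the apparitions counted on the left are the visits of
    the orbit of x to [lift_cyl w u']. *)
Lemma nu_apE x n w u' : (size w <= n)%N ->
  nu_ap R h (factor x 0 l) u' w (factor (eta h x) 0 n) =
  avg R (n - size w).+1 (lift_cyl w u') x.
Proof.
move=> wn; rewrite /nu_ap /avg; set v := factor (eta h x) 0 n.
have -> : #|Ap_to h (factor x 0 l) u' w v|%:R =
    \sum_(j < (size v - size w).+1) ((take (size w) (drop j v) == w) &&
      (Phi h (take j v) (factor x 0 l) == u'))%:R :> R.
  by rewrite -sum1_card natr_sum big_mkcond; apply: eq_bigr => j _;
    rewrite !inE; case: (_ && _).
rewrite !size_tuple; congr (_ / _); apply: eq_bigr => j _.
have jn := ltn_ord j.
rewrite take_drop_factor ?add0r; last by lia.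
congr (nat_of_bool _)%:R; rewrite in_lift_cyl andbC factor_translate add0r.
have -> : take j v = factor (eta h x) 0 j :> seq _.
  have := @take_drop_factor k (eta h x) 0 0 j n; rewrite drop0 addr0; apply; lia.
rewrite (PhiE hh (erefl (factor x 0 l))) ?size_tuple; last first.
  by move=> i ij; rewrite nth_factor ?add0r.
congr (_ && _); rewrite eta_translate; apply/eqP/idP => [E|/set_mem].
  by apply/mem_set/cylinderP; rewrite factor_translate add0r.
by rewrite cylinderP factor_translate add0r.
Qed.

(** At every time j the windows of the points s u are pairwise distinct, so
    exactly one of them is u'. *)
Lemma sum_start_avg N w u' y (s : l.-tuple 'I_k.+1 -> config k) :
  (forall u, eta h (s u) = y /\ factor (s u) 0 l = u) ->
  \sum_u avg R N (lift_cyl w u') (s u) = avg R N (cylinder w) y.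
Proof.
move=> sP; rewrite -mulr_suml exchange_big/=; congr (_ / _); apply: eq_bigr => j _.
pose f u := factor (s u) j%:Z l.
have f_inj : injective f.
  move=> u1 u2 f12; rewrite -(sP u1).2 -[RHS](sP u2).2.
  suff -> : s u1 = s u2 by [].
  by apply: (eta_window_inj hh _ f12); rewrite (sP u1).1 (sP u2).1.
have [g fg gf] := injF_bij f_inj.
rewrite (bigD1 (g u'))//= big1 ?addr0 => [|u uu'].
  rewrite in_lift_cyl factor_translate add0r -/(f _) gf eqxx.
  by rewrite eta_translate (sP _).1.
rewrite in_lift_cyl factor_translate add0r -/(f _) (_ : (f u == u') = false)//.
by apply: contraNF uu' => /eqP <-; rewrite fg.
Qed.

End Frequencies.

(** * The two conditions and uniform frequencies *)

Section Suprema.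
Variable R : realType.

Lemma sup_cvg0_le (F : nat -> nat -> R) (M : R) :
  (forall n i, F n i <= M) ->
  (fun n => sup [set F n i | i in [set i | (0 < i)%N]]) @ \oo --> (0 : R) ->
  forall e : R, 0 < e ->
  exists N0, forall n i, (N0 <= n)%N -> (0 < i)%N -> F n i <= e.
Proof.
move=> FM /cvgrPdist_lt F0 e /F0 [N _ NF]; exists N => n i Nn i0.
have := NF n Nn; rewrite sub0r normrN => /ltW /(le_trans (ler_norm _)).
apply: le_trans; apply: ub_le_sup; last by exists i.
by exists M => _ [j _ <-].
Qed.

Lemma sup_cvg0 (F : nat -> nat -> R) :
  (forall e : R, 0 < e ->
   exists N0, forall n i, (N0 <= n)%N -> (0 < i)%N -> `|F n i| <= e) ->
  (fun n => sup [set F n i | i in [set i | (0 < i)%N]]) @ \oo --> (0 : R).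
Proof.
move=> FE; apply/cvgrPdist_le => e e0; have [N NF] := FE e e0.
exists N => // n /= Nn; rewrite sub0r normrN ler_norml; apply/andP; split.
  have := NF n 1%N Nn isT; rewrite ler_norml => /andP[+ _] => /le_trans; apply.
  apply: ub_le_sup; last by exists 1%N.
  exists e => _ [j j0 <-]; exact: le_trans (ler_norm _) (NF n j Nn j0).
apply: ge_sup; first by exists (F n 1%N), 1%N.
by move=> _ [j j0 <-]; exact: le_trans (ler_norm _) (NF n j Nn j0).
Qed.

Variables (I : finType) (i0 : I).
Implicit Type F : I -> R.

Lemma le_fmax F i : F i <= fmax i0 F.
Proof. exact: le_bigmax. Qed.

Lemma fmax_le F c : (forall i, F i <= c) -> fmax i0 F <= c.
Proof. by move=> Fc; apply/bigmax_leP; split. Qed.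

Lemma norm_fmax_le F c : (forall i, `|F i| <= c) -> `|fmax i0 F| <= c.
Proof.
move=> Fc; rewrite ler_norml; apply/andP; split.
  have := Fc i0; rewrite ler_norml => /andP[+ _] => /le_trans; apply.
  exact: le_fmax.
by apply: fmax_le => i; apply: le_trans (ler_norm _) (Fc i).
Qed.

End Suprema.

Section FiniteFamilies.
Variables (R : realType) (T : finType) (a : T -> R) (f m d : R).
Hypotheses (sum_a : \sum_t a t = f) (fm : `|f - m| <= d).

Let K : R := #|T|%:R.

(** The mean f/K of the family is within d of m/K, because K >= 1, and a t0 is
    within e of the mean if it is within e of every member. *)
Lemma spread_close (e : R) t0 : (forall t, `|a t0 - a t| <= e) ->
  `|a t0 - m / K| <= e + d.
Proof.
move=> ae.
have K1 : 1 <= K by rewrite ler1n; apply/card_gt0P; exists t0.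
have K0 : 0 < K by lra.
have afE : K * a t0 - f = \sum_t (a t0 - a t).
  by rewrite sumrB sumr_const sum_a mulr_natl.
have : `|K * a t0 - f| <= K * e.
  rewrite afE; apply: le_trans (ler_norm_sum _ _ _) _.
  apply: le_trans (ler_sum _ (fun t _ => ae t)) _.
  by rewrite sumr_const -mulr_natl.
move=> H; have {}H : `|K * a t0 - m| <= K * e + d.
  rewrite (_ : _ - m = (K * a t0 - f) + (f - m)); last by lra.
  by apply: le_trans (ler_normD _ _) _; apply: lerD.
have -> : a t0 - m / K = (K * a t0 - m) / K by rewrite mulrBl mulrAC divff ?mul1r ?gt_eqF.
rewrite normrM (gtr0_norm (x := K^-1)) ?invr_gt0// ler_pdivrMr// (le_trans H)//.
have d0 : 0 <= d := le_trans (normr_ge0 _) fm.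
rewrite mulrDl mulrC lerD2l; exact: ler_peMr.
Qed.

(** The total is nearly m, so a term can fall below m/K only by what the
    other terms exceed it, up to d. *)
Lemma upper_close (e : R) : 0 <= e -> (forall t, a t <= m / K + e) ->
  forall t, `|a t - m / K| <= K * e + d.
Proof.
move=> e0 ae t0.
have K1 : 1 <= K by rewrite ler1n; apply/card_gt0P; exists t0.
have d0 : 0 <= d := le_trans (normr_ge0 _) fm.
have KmK : K * (m / K) = m by rewrite mulrC divfK// gt_eqF//; lra.
have : \sum_t (m / K + e - a t) = m + K * e - f.
  by rewrite sumrB sumr_const sum_a -[in LHS]mulr_natl mulrDr KmK.
rewrite (bigD1 t0)//=; set S := \sum_(t | _) _.
have S0 : 0 <= S by apply: sumr_ge0 => t _; rewrite subr_ge0.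
move=> E; have := ae t0; move: fm; rewrite !ler_norml => /andP[H1 H2] H3.
have Ke : e <= K * e by exact: ler_peMl.
by apply/andP; split; lra.
Qed.

End FiniteFamilies.

Section Conditions.
Variables (R : realType) (k l : nat) (h : block_code k l).
Variables (Y : set (config k)) (mu : probability (borel k) R).
Hypotheses (sY : subshift Y) (uY : uniquely_ergodic R Y) (iY : invariant_measure Y mu).
Implicit Types (y : config k) (w : seq 'I_k.+1).

(** The mass which the only candidate for an invariant measure on the preimage
    of Y gives to [lift_cyl w u], whatever u is. *)
Definition lift_freq w : R := fine (mu (cylinder w)) / k.+1%:R ^+ l.

(** The two-sided form of the conditions to be compared, which is the one that
    ergodic averages satisfy. *)
Definition uniform_nu y w := forall e : R, 0 < e ->
  exists N0, forall n i, (N0 <= n)%N -> (0 < i)%N -> forall u u',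
    `|nu_ap R h u u' w (factor y i%:Z n.+1) - lift_freq w| <= e.

Lemma card_words : #|{: l.-tuple 'I_k.+1}|%:R = k.+1%:R ^+ l :> R.
Proof. by rewrite card_tuple card_ord natrX. Qed.

Lemma factor_shift y (i : int) n : factor y i n = factor (translate i y) 0 n.
Proof. by rewrite factor_translate add0r. Qed.

(** The total frequency of w converges by unique ergodicity of Y alone. *)
Lemma uniform_Ap y w (e : R) : Y y -> 0 < e ->
  exists N0, forall n (i : int) u, (N0 <= n)%N ->
    `|\sum_u' nu_ap R h u u' w (factor y i n.+1) - fine (mu (cylinder w))| <= e.
Proof.
move=> Yy e0; have [N NP] := uniform_avg sY uY iY (local_cylinder w) e0.
exists (N + size w)%N => n i u Nn; rewrite sum_nu_ap factor_shift card_Ap; last by lia.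
by apply: NP; [lia|exact: subshift_translate].
Qed.

Lemma uniform_nu_equidistributed y w : uniform_nu y w -> equidistributed R h y w.
Proof.
move=> H; apply: sup_cvg0 => e e0; have [|N NP] := H (e / 2); first by lra.
exists N => n i Nn i0; apply: norm_fmax_le => u; apply: norm_fmax_le => -[u1 u2] /=.
have := NP n i Nn i0 u u1; have := NP n i Nn i0 u u2.
by rewrite normr_id !ler_norml => /andP[? ?] /andP[? ?]; apply/andP; split; lra.
Qed.

Lemma equidistributed_uniform_nu y w : Y y -> equidistributed R h y w -> uniform_nu y w.
Proof.
move=> Yy H e e0.
have e20 : 0 < e / 2 by lra.
have [|N1 N1P] := sup_cvg0_le (M := 1) _ H e20.
  move=> n i; apply: fmax_le => u; apply: fmax_le => -[u1 u2] /=.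
  have := nu_ap_ge0 R h u u1 w (factor y i n.+1).
  have := nu_ap_le1 R h u u1 w (factor y i n.+1).
  have := nu_ap_ge0 R h u u2 w (factor y i n.+1).
  have := nu_ap_le1 R h u u2 w (factor y i n.+1).
  by rewrite ler_norml => ? ? ? ?; apply/andP; split; lra.
have [N2 N2P] := uniform_Ap w Yy e20.
exists (maxn N1 N2) => n i; rewrite geq_max => /andP[n1 n2] i0 u u'.
rewrite /lift_freq -card_words (_ : e = e / 2 + e / 2); last by lra.
apply: (spread_close (erefl _) (N2P n i%:Z u n2)) => u''.
apply: le_trans (N1P n i n1 i0); apply: le_trans (le_fmax _ _ u).
exact: (le_fmax _ (fun p => `|nu_ap R h u p.1 w (factor y i n.+1)
  - nu_ap R h u p.2 w (factor y i n.+1)|) (u', u'')).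
Qed.

Lemma uniform_nu_frequency y w : uniform_nu y w -> uniform_frequency h mu y w.
Proof.
move=> H; apply: sup_cvg0 => e e0; have [N NP] := H e e0.
exists N => n i Nn i0; apply: norm_fmax_le => -[u1 u2] /=.
exact: NP.
Qed.

(** The condition bounds the frequencies from above only; the lower bound comes
    from their sum.  The tolerance is divided by the number K of windows
    because one frequency can fall by as much as all the others exceed. *)
Lemma frequency_uniform_nu y w : Y y -> uniform_frequency h mu y w -> uniform_nu y w.
Proof.
move=> Yy H e e0.
pose K : R := #|{: l.-tuple 'I_k.+1}|%:R.
have K1 : 1 <= K by rewrite ler1n; apply/card_gt0P; exists (zero_word k l).
have e1 : 0 < e / 2 / K by rewrite !divr_gt0//; lra.
have e2 : 0 < e / 2 by lra.
have [|N1 N1P] := sup_cvg0_le (M := 1 - lift_freq w) _ H e1.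
  by move=> n i; apply: fmax_le => -[u1 u2] /=; rewrite lerD2r nu_ap_le1.
have [N2 N2P] := uniform_Ap w Yy e2.
exists (maxn N1 N2) => n i; rewrite geq_max => /andP[n1 n2] i0 u u'.
rewrite /lift_freq -card_words.
have := @upper_close _ _ _ _ _ _ (erefl _) (N2P n i%:Z u n2) _ (ltW e1) _ u'.
rewrite -/K [K * _]mulrC divfK ?gt_eqF//; last by lra.
rewrite (_ : e / 2 + e / 2 = e); last by lra.
apply=> u''; rewrite addrC -lerBlDr.
apply: le_trans (N1P n i n1 i0); rewrite /K card_words.
exact: (le_fmax _ (fun p => nu_ap R h p.1 p.2 w (factor y i n.+1)
  - lift_freq w) (u, u'')).
Qed.

End Conditions.

(** * Strict ergodicity of the preimage *)

Section Measures.
Variables (R : realType) (k : nat).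
Implicit Types (x y z : config k) (w : seq 'I_k.+1) (Y Z : set (config k)).

Lemma avg_gt0_visit N (B : set (config k)) x : 0 < avg R N B x ->
  exists j : nat, B (translate j%:Z x).
Proof.
apply: contraPP => /forallNP noB; apply/negP; rewrite -leNgt /avg big1 ?mul0r// => j _.
by case: (boolP (_ \in B)) => // /set_mem /noB.
Qed.

Lemma invariant_measure_nonempty Z (p : probability (borel k) R) :
  invariant_measure Z p -> Z !=set0.
Proof.
move=> [pZ _]; apply/set0P/eqP => Z0; move: pZ; rewrite Z0 measure0 => /esym/eqP.
by rewrite onee_eq0.
Qed.

Lemma language_factor Y x (a : int) n : Y x -> language Y (factor x a n).
Proof. by move=> Yx; exists x => //; exists a; rewrite size_tuple. Qed.

Lemma invariant_translateN Z (p : probability (borel k) R) (B : set (borel k)) j :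
  invariant_measure Z p -> measurable B -> p (translate (- j%:Z) @^-1` B) = p B.
Proof.
move=> pinv mB; rewrite -(invariant_translate j pinv).
  congr (p _); apply/seteqP; split=> x;
  by rewrite /preimage/= translateD addrC subrr translate0.
by rewrite -[X in measurable X]setTI; apply: measurable_translate.
Qed.

(** By minimality the translates of the cylinder cover Y, and by invariance
    they all have the same measure. *)
Lemma cylinder_mu_gt0 Y (mu : probability (borel k) R) w :
  subshift Y -> minimal Y -> invariant_measure Y mu -> language Y w ->
  0 < fine (mu (cylinder w)).
Proof.
move=> sY minY imu [y0 Yy0 [n0 wE]].
have mw : measurable (cylinder w : set (borel k)).
  by apply: measurable_local; exact: local_cylinder.
apply: fine_gt0; rewrite lt0e measure_ge0 ltey_eq fin_num_measure// !andbT.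
apply/eqP => mu0.
have visit x : Y x -> exists m : int, cylinder w (translate m x).
  move=> Yx; have Yz := subshift_translate n0 sY Yy0.
  have [|_ [[m ->] wm]] := minY x Yx _ Yz (cylinder w); last by exists m.
  apply: open_nbhs_nbhs; split; first exact/local_open/local_cylinder.
  by apply/cylinderP; rewrite factor_translate add0r -wE.
have mY : measurable (Y : set (borel k)) by apply: measurable_closed; case: sY.
(* A countable union of null translates of the cylinder would cover Y. *)
suff : mu.-negligible (Y : set (borel k)).
  move=> /(negligibleP _ mY) muY; have mu1 := proj1 imu.
  by have /eqP := eq_trans (esym mu1) muY; rewrite onee_eq0.
apply: (@negligibleS _ _ _ _ (\bigcup_n ((translate n%:Z @^-1` cylinder w)
    `|` (translate (- n%:Z) @^-1` cylinder w)) : set (borel k))).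
  move=> x /visit [[m|m] wm]; first by exists m => //; left.
  by exists m.+1 => //; right; rewrite -NegzE.
apply: negligible_bigcup => n; apply: negligibleU; apply/negligibleP.
- by rewrite -[X in measurable X]setTI; apply: measurable_translate.
- by apply: (etrans (invariant_translate n imu mw)).
- by rewrite -[X in measurable X]setTI; apply: measurable_translate.
- by apply: (etrans (invariant_translateN n imu mw)).
Qed.

(** An occurrence at a positive position is needed, where minimality speaks of
    two-sided orbits; the positive limit of the averages along the forward
    orbit of the translate of y by 1 provides it. *)
Lemma language_occurs Y (mu : probability (borel k) R) y w :
  subshift Y -> minimal Y -> uniquely_ergodic R Y -> invariant_measure Y mu ->
  Y y -> language Y w -> exists2 i : nat, (0 < i)%N & factor y i%:Z (size w) = w :> seq _.
Proof.
move=> sY minY uY imu Yy Lw.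
have mw := cylinder_mu_gt0 sY minY imu Lw.
have [|N NP] := uniform_avg (e := fine (mu (cylinder w)) / 2) sY uY imu (local_cylinder w).
  by lra.
have := NP N _ (leqnn _) (subshift_translate 1 sY Yy).
rewrite ler_norml => /andP[H _].
have [|j] := @avg_gt0_visit N (cylinder w) (translate 1 y); first by lra.
rewrite translateD => /cylinderP; rewrite factor_translate add0r => wj.
by exists j.+1 => //; rewrite (_ : Posz j.+1 = j%:Z + 1)//; lia.
Qed.

End Measures.

Section Lift.
Variables (R : realType) (k l : nat) (h : block_code k l).
Variables (Y : set (config k)) (mu : probability (borel k) R).
Hypotheses (sY : subshift Y) (minY : minimal Y) (uY : uniquely_ergodic R Y).
Hypotheses (iY : invariant_measure Y mu) (hh : permutative h).
Implicit Types (x y z : config k) (w : seq 'I_k.+1) (u : l.-tuple 'I_k.+1).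

Notation X := (eta h @^-1` Y).

(** Average [sum_start_avg] over a long time: the left-hand side tends to K
    times the measure of the lifted cylinder, the right-hand side to mu[w]. *)
Lemma lifted_measure (m : probability (borel k) R) w u :
  uniquely_ergodic R X -> invariant_measure X m ->
  fine (m (lift_cyl h w u)) = lift_freq l mu w.
Proof.
move=> uX iX; have [y Yy] := invariant_measure_nonempty iY.
have [s sP] : exists s : l.-tuple 'I_k.+1 -> config k,
    forall u, eta h (s u) = y /\ factor (s u) 0 l = u.
  have ex u' : {x | eta h x = y /\ factor x 0 l = u'}.
    by apply: cid; have [x] := eta_section hh y u'; exists x.
  by exists (fun u' => sval (ex u')) => u'; exact: svalP (ex u').
pose K : R := #|{: l.-tuple 'I_k.+1}|%:R.
have K1 : 1 <= K by rewrite ler1n; apply/card_gt0P; exists u.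
set a := fine _.
suff : fine (mu (cylinder w)) = K * a.
  by rewrite /lift_freq => ->; rewrite /K card_words mulrAC divff ?mul1r// expf_neq0 ?pnatr_eq0.
apply/eqP; rewrite -subr_eq0 -normr_le0; apply/ler_addgt0Pr => e e0; rewrite add0r.
pose e' := e / (K + 1); have e'0 : 0 < e' by rewrite divr_gt0//; lra.
have [N1 N1P] := uniform_avg sY uY iY (local_cylinder w) e'0.
have [N2 N2P] := uniform_avg (subshift_eta h sY) uX iX (local_lift_cyl h w u) e'0.
pose N := maxn N1 N2.
have H1 := N1P N y (leq_maxl _ _) Yy.
have H2 u' : `|avg R N (lift_cyl h w u) (s u') - a| <= e'.
  by apply: N2P; [exact: leq_maxr|rewrite /preimage/= (sP u').1].
have H3 : `|avg R N (cylinder w) y - K * a| <= K * e'.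
  have -> : avg R N (cylinder w) y - K * a =
      \sum_u' (avg R N (lift_cyl h w u) (s u') - a).
    by rewrite sumrB sumr_const (sum_start_avg R hh N w u sP) mulr_natl.
  apply: le_trans (ler_norm_sum _ _ _) _.
  apply: le_trans (ler_sum _ (fun t _ => H2 t)) _.
  by rewrite sumr_const -mulr_natl.
have -> : e = K * e' + e'.
  transitivity (e' * (K + 1)); last by lra.
  by rewrite /e' divfK// gt_eqF//; lra.
move: H1 H3; rewrite !ler_norml => /andP[? ?] /andP[? ?]; apply/andP; split; lra.
Qed.

(** The averages of the lifted cylinders converge uniformly on the preimage of
    Y, in particular at the points above the translates of y. *)
Lemma uniquely_ergodic_uniform_nu y w :
  uniquely_ergodic R X -> Y y -> uniform_nu h mu y w.
Proof.
move=> uX Yy e e0; have [m iX _] := uX.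
have NP u' := uniform_avg (subshift_eta h sY) uX iX (local_lift_cyl h w u') e0.
pose N0 u' := sval (cid (NP u')); have N0P u' := svalP (cid (NP u')).
exists (\max_u' N0 u' + size w)%N => n i Nn _ u u'.
have [x xy xu] := eta_section hh (translate i%:Z y) u.
rewrite factor_shift -xy -{1}xu nu_apE//; last by lia.
rewrite -(lifted_measure w u' uX iX); apply: N0P.
  by have := leq_bigmax u' (F := N0); rewrite -/(N0 u'); lia.
by rewrite /preimage/= xy; exact: subshift_translate.
Qed.

Lemma lift_freq_gt0 w : language Y w -> 0 < lift_freq l mu w.
Proof.
move=> Lw; rewrite /lift_freq divr_gt0// ?exprn_gt0 ?ltr0n//.
exact: cylinder_mu_gt0 Lw.
Qed.

Variable y : config k.
Hypotheses (Yy : Y y) (uy : forall w, language Y w -> uniform_nu h mu y w).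

(** The frequencies in a word of eta x can be read at an occurrence of this
    word in y. *)
Lemma uniform_lift_avg w u (e : R) : language Y w -> 0 < e ->
  exists N0, forall N x, (N0 <= N)%N -> X x ->
    `|avg R N (lift_cyl h w u) x - lift_freq l mu w| <= e.
Proof.
move=> Lw e0; have [N0 NP] := uy Lw e0.
exists (N0 + 2)%N => N x NN Xx.
(* Words with n + 1 letters have N positions at which w can start. *)
pose n := (N + size w - 2)%N.
have [i i0] := language_occurs sY minY uY iY Yy (@language_factor _ Y (eta h x) 0 n.+1 Xx).
rewrite size_tuple => /val_inj iE.
have := NP n i _ i0 (factor x 0 l) u; rewrite iE nu_apE//; last by lia.
rewrite (_ : (n.+1 - size w).+1 = N); last by lia.
by apply; lia.
Qed.

(** Lifted cylinders are the cylinders of words of length at least l. *)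
Lemma lift_cyl_factor z m :
  lift_cyl h (factor (eta h z) 0 m) (factor z 0 l) =
  [set x | factor x 0 (m + l) = factor z 0 (m + l)].
Proof.
apply/seteqP; split=> x /=.
  move=> [xz /cylinder_factorP/factorP E].
  by apply: eta_prefix_determined => // i im; apply: E.
move=> /factorP E; split.
  by apply/factorP => i il; apply: E; lia.
apply/cylinder_factorP/factorP => i im; rewrite !add0r.
congr (h _); apply/factorP => j jl.
by have := E (i + j)%N; rewrite PoszD !add0r; apply; lia.
Qed.

(** Translate the window to the origin, where it is a lifted cylinder with
    uniformly converging averages. *)
Lemma invariant_window (p : probability (borel k) R) z n :
  invariant_measure X p -> X z ->
  fine (p [set x | factor x (- n%:Z) (n.*2.+1 + l) = factor z (- n%:Z) (n.*2.+1 + l)]) =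
  lift_freq l mu (factor (eta h z) (- n%:Z) n.*2.+1).
Proof.
move=> pX Xz; set W := [set x | _]; set w := factor _ _ _.
pose z' := translate (- n%:Z) z.
have wE : w = factor (eta h z') 0 n.*2.+1.
  by rewrite /z' eta_translate factor_translate add0r.
have lW : local W.
  exists (n + l)%N => x t xt xW; rewrite /W /= -xW.
  by apply/factorP => i il; rewrite xt//; lia.
have mW : measurable (W : set (borel k)) by exact: measurable_local.
rewrite -(invariant_translate n pX mW).
have -> : translate n%:Z @^-1` W = lift_cyl h w (factor z' 0 l).
  rewrite wE lift_cyl_factor /W; apply/seteqP; split=> x;
  by rewrite /preimage/= !factor_translate addNr add0r.
have Lw : language Y w by exact: language_factor.
apply/eqP; rewrite -subr_eq0 -normr_le0; apply/ler_addgt0Pr => e e0; rewrite add0r.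
have [N NP] := uniform_lift_avg (factor z' 0 l) Lw e0.
apply: (invariant_avg (N := N.+1) (subshift_eta h sY) pX) => //.
  by apply: measurable_local; exact: local_lift_cyl.
by move=> x Xx; apply: NP.
Qed.

(** A clopen set is a finite disjoint union of centred cylinders, and an
    invariant measure gives a cylinder either the mass computed in
    [invariant_window] or zero, when it does not meet the preimage of Y. *)
Lemma uniquely_ergodic_lift : uniquely_ergodic R X.
Proof.
have [x xy _] := eta_section hh y (zero_word k l).
have [|p pX] := @exists_invariant_measure R k X (subshift_eta h sY).
  by exists x; rewrite /preimage/= xy.
exists p => // q qX; apply: eq_prob_local; first exact: probability_setT.
move=> A [n nA].
(* The window starts at - n, covers [-n, n], and is long enough for its
   cylinders to be translates of lifted ones. *)
pose W (t : (n.*2.+1 + l).-tuple 'I_k.+1) : set (borel k) :=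
  A `&` [set x | factor x (- n%:Z) (n.*2.+1 + l) = t].
have AE : A = \bigcup_(t in setT) W t.
  apply/seteqP; split=> [z Az|z [t _ []]//].
  by exists (factor z (- n%:Z) (n.*2.+1 + l)).
have lW t : local (W t).
  exists (n + l)%N => z z' zz' [Az zt]; split.
    by apply: nA Az; apply: agreeW zz'; lia.
  by rewrite /= -zt; apply/factorP => i il; rewrite zz'//; lia.
have mW t : measurable (W t) by exact: measurable_local.
have tW : trivIset setT W.
  by move=> s t _ _ [z [[_ zs] [_ zt]]]; rewrite -zs -zt.
rewrite AE !measure_fin_bigcup//; try exact: finite_finset.
apply: eq_fsbigr => t _.
have [[z [[Az zt] Xz]]|] := pselect (exists z, W t z /\ X z).
  have -> : W t = [set x | factor x (- n%:Z) (n.*2.+1 + l) =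
                           factor z (- n%:Z) (n.*2.+1 + l)].
    rewrite /= in zt; apply/seteqP; split=> [z' [_ /= z't]|z' /= z'z].
      by rewrite z't zt.
    split; last by rewrite /= z'z.
    apply: nA Az => i ni; move/factorP: z'z => /(_ (absz (i + n%:Z))).
    rewrite (_ : - n%:Z + (absz (i + n%:Z)) = i); last by lia.
    by move=> ->//; lia.
  have fin_p (r : probability (borel k) R) (B : set (borel k)) :
    measurable B -> r B = (fine (r B))%:E by move=> mB; rewrite fineK// fin_num_measure.
  have mWz : measurable ([set x | factor x (- n%:Z) (n.*2.+1 + l) =
      factor z (- n%:Z) (n.*2.+1 + l)] : set (borel k)).
    apply: measurable_local; exists (n + l)%N => z1 z2 z12 /= <-.
    by apply/factorP => i il; rewrite z12//; lia.
  apply: etrans (fin_p q _ mWz) _; apply: esym; apply: etrans (fin_p p _ mWz) _.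
  by rewrite !invariant_window.
move=> /forallNP noX.
have WX : W t `&` X = set0 by apply/seteqP; split=> // z; exact: noX.
have [cX _] := subshift_eta h sY.
exact: etrans (invariant_null cX qX (mW t) WX) (esym (invariant_null cX pX (mW t) WX)).
Qed.

(** The averages of every lifted cylinder which meets the preimage of Y have a
    positive limit along every orbit. *)
Lemma minimal_lift : minimal X.
Proof.
move=> x Xx z Xz V /agree_nbhs [n nV].
pose z' := translate (- n%:Z) z; pose w := factor (eta h z') 0 n.*2.+1.
have Xz' : X z' by exact: subshift_translate (subshift_eta h sY) Xz.
have Lw : language Y w by exact: language_factor.
have f0 := lift_freq_gt0 Lw.
have [|N NP] := uniform_lift_avg (e := lift_freq l mu w / 2) (factor z' 0 l) Lw; first by lra.
have := NP N x (leqnn _) Xx; rewrite ler_norml => /andP[H _].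
have [|j] := @avg_gt0_visit R k N (lift_cyl h w (factor z' 0 l)) x; first by lra.
rewrite lift_cyl_factor => /= /factorP E.
exists (translate (j%:Z + n%:Z) x); split; first by exists (j%:Z + n%:Z).
apply: nV => i ni /=.
have := E (absz (i + n%:Z)); rewrite !add0r /z' /translate => /(_ _)/esym.
rewrite (_ : Posz (absz (i + n%:Z)) - n%:Z = i); last by lia.
by move=> ->; [congr (x _); lia|lia].
Qed.

End Lift.

Theorem theorem5p4 (R : realType) (k l : nat) (Y : set (config k))
    (mu : probability (borel k) R) (h : block_code k l)
    (hY : strictly_ergodic R Y) (hmu : invariant_measure Y mu)
    (hh : permutative h) :
  (strictly_ergodic R (eta h @^-1` Y) <->
     exists2 y, Y y & forall w, language Y w -> equidistributed R h y w) /\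
  (forall y w, Y y -> language Y w ->
     (equidistributed R h y w <-> uniform_frequency h mu y w)).
Proof.
have [sY minY uY] := hY; split; last first.
  move=> y w Yy _; split=> H.
    apply: uniform_nu_frequency.
    exact: (equidistributed_uniform_nu sY uY hmu Yy H).
  apply: uniform_nu_equidistributed.
  exact: (frequency_uniform_nu sY uY hmu Yy H).
split=> [[_ _ uX]|[y Yy yw]].
  have [y Yy] := invariant_measure_nonempty hmu.
  exists y => // w _; apply: uniform_nu_equidistributed.
  exact: (uniquely_ergodic_uniform_nu sY uY hmu hh w uX Yy).
have uy w : language Y w -> uniform_nu h mu y w.
  by move=> /yw H; exact: (equidistributed_uniform_nu sY uY hmu Yy H).
split; first exact: subshift_eta.
- exact: (minimal_lift sY minY uY hmu hh Yy uy).
- exact: (uniquely_ergodic_lift sY minY uY hmu hh Yy uy).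
Qed.
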